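(* For $n\ge 2$, $a_n(12;2\to 3)=2B_{n-1}$, and $a_1(12;2\to 3)=1$, where $B_m$ is the $m$-th Bell number.
   Context: Standard cycle form of $\sigma\in S_n$: product of disjoint cycles (fixed points included), each cycle starting with its largest element, cycles listed in increasing order of largest elements. The fundamental bijection $\theta:S_n\to S_n$ erases the parentheses of the standard cycle form to give a one-line permutation. For $\pi\in S_n$, $\hat\pi=\theta^{-1}(\pi)$. An arrow pattern $(\nu;H)$ of size $k$: a string $\nu=a_1\dots a_m$ of positive integers and a set $H$ of arrows $b\to c$, with all integers appearing forming $[k]$. $\pi\in S_n$ contains $(\nu;H)$ if there is $X=\{x_1<\dots<x_k\}\subseteq[n]$ with positions $t_1<\dots<t_m$ such that $\pi_{t_1}\cdots\pi_{t_m}=x_{a_1}\cdots x_{a_m}$ and $\hat\pi(x_b)=x_c$ for every arrow $b\to c\in H$; otherwise it avoids it. $a_n(\nu;H)$ = number of $\pi\in S_n$ avoiding $(\nu;H)$. $B_m$ is the number of set partitions of $[m]$. *)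

(* Defs.v *)
From mathcomp Require Import all_boot all_fingroup.

Set Implicit Arguments.
Unset Strict Implicit.
Unset Printing Implicit Defensive.

(* The sets [n] and [k] are represented by 'I_n and 'I_k, so every value,
   position and letter is shifted down by one; only their order matters. *)

Section FundamentalBijection.

Variable n : nat.
Implicit Types (s t pi : {perm 'I_n}) (m x y : 'I_n).

Definition one_line pi : seq 'I_n := [seq pi i | i <- enum 'I_n].

Definition cycle_max s m := [forall x in porbit s m, x <= m].

(* [enum 'I_n] is increasing, so the cycles come in increasing order of their
   largest elements; fixed points are the cycles of length one. *)
Definition standard_cycles s : seq (seq 'I_n) :=
  [seq traject s m #|porbit s m| | m <- enum 'I_n & cycle_max s m].

Definition erased s : seq 'I_n := flatten (standard_cycles s).

Lemma cycle_max_ex s x : exists2 m, cycle_max s m & x \in porbit s m.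
Proof.
have [m mx hm] := @arg_maxnP _ x (fun y => y \in porbit s x) val (porbit_id s x).
have e : porbit s m = porbit s x by apply/eqP; rewrite eq_porbit_mem.
exists m; last by rewrite e porbit_id.
by apply/forall_inP => y; rewrite e => /hm.
Qed.

Lemma cycle_max_inj s m1 m2 x : cycle_max s m1 -> cycle_max s m2 ->
  x \in porbit s m1 -> x \in porbit s m2 -> m1 = m2.
Proof.
rewrite -!eq_porbit_mem => /forall_inP h1 /forall_inP h2 /eqP e1 /eqP e2.
apply: val_inj; apply/eqP; rewrite eqn_leq h2 ?h1 //.
  by rewrite -e1 e2 porbit_id.
by rewrite -e2 e1 porbit_id.
Qed.

Lemma mem_erased s x : x \in erased s.
Proof.
have [m hm xm] := cycle_max_ex s x.
apply/flattenP; exists (traject s m #|porbit s m|); last by rewrite -porbit_traject.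
by apply/mapP; exists m; rewrite // mem_filter hm mem_enum.
Qed.

Lemma uniq_erased s : uniq (erased s).
Proof.
rewrite /erased /standard_cycles.
have: all (cycle_max s) [seq m <- enum 'I_n | cycle_max s m] by apply: filter_all.
have: uniq [seq m <- enum 'I_n | cycle_max s m] by rewrite filter_uniq ?enum_uniq.
elim: (filter _ _) => //= m ms IH /andP[mNms u] /andP[hm hms].
rewrite cat_uniq uniq_traject_porbit IH // andbT /=.
apply/hasPn => x /flattenP[_ /mapP[m' m'ms ->]].
rewrite -!porbit_traject => xm'; apply: contra mNms => xm.
by rewrite (cycle_max_inj hm (allP hms _ m'ms) xm xm').
Qed.

Lemma size_erased s : size (erased s) = n.
Proof.
rewrite -[RHS]card_ord -(card_uniqP (uniq_erased s)).
by apply: eq_card => x; rewrite mem_erased.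
Qed.

Lemma theta_proof s : injective (fun i : 'I_n => nth i (erased s) i).
Proof.
move=> i j; rewrite (set_nth_default i) ?size_erased // => /eqP.
by rewrite nth_uniq ?size_erased ?uniq_erased // => /eqP/val_inj.
Qed.

Definition theta s : {perm 'I_n} := perm (@theta_proof s).

Lemma one_line_theta s : one_line (theta s) = erased s.
Proof.
case: (posnP n) => [n0 | n_gt0].
  apply: (@etrans _ _ [::]); [apply: size0nil | apply/esym/size0nil].
    by rewrite size_map size_enum_ord.
  by rewrite size_erased.
have x0 : 'I_n := Ordinal n_gt0.
apply: (@eq_from_nth _ x0); first by rewrite size_map size_enum_ord size_erased.
move=> i; rewrite size_map size_enum_ord => lt_in.
rewrite (nth_map x0) ?size_enum_ord // permE nth_enum_ord //.
by apply: set_nth_default; rewrite size_erased.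
Qed.

Lemma split_block m (r r' w w' : seq 'I_n) :
    all (fun x => x < m) r -> all (fun x => x < m) r' ->
    (if w is y :: _ then m < y else true) ->
    (if w' is y :: _ then m < y else true) ->
  r ++ w = r' ++ w' -> r = r' /\ w = w'.
Proof.
move=> hr hr' hw hw' e.
have sz (q v : seq 'I_n) : all (fun x => x < m) q ->
    (if v is y :: _ then m < y else true) ->
    find (fun x => m < x) (q ++ v) = size q.
  move=> hq hv; rewrite find_cat; case: ifP => [/hasP[x xq]|_].
    by rewrite ltnNge ltnW // (allP hq).
  by case: v hv => [|y v] /= h; rewrite ?h addn0.
have es : size r = size r' by rewrite -(sz r w) // e sz.
by move/eqP: e; rewrite eqseq_cat // => /andP[/eqP-> /eqP->].
Qed.

Lemma flatten_blocks_inj (f g : 'I_n -> seq 'I_n) ms ms' :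
    (forall m, m \in ms -> all (fun x => x < m) (f m)) ->
    (forall m, m \in ms' -> all (fun x => x < m) (g m)) ->
    pairwise (fun x y => x < y) ms -> pairwise (fun x y => x < y) ms' ->
    flatten [seq m :: f m | m <- ms] = flatten [seq m :: g m | m <- ms'] ->
  [seq m :: f m | m <- ms] = [seq m :: g m | m <- ms'].
Proof.
elim: ms ms' => [|m ms IH] [|m' ms'] //= hf hg /andP[lm pm] /andP[lm' pm'] [em].
subst m' => e.
have [||||ef {}e] := split_block (m := m) _ _ _ _ e.
- by rewrite hf ?mem_head.
- by rewrite hg ?mem_head.
- by case: (ms) lm => //= y ? /andP[].
- by case: (ms') lm' => //= y ? /andP[].
rewrite ef; congr (_ :: _); apply: IH => // y hy.
  by apply: hf; rewrite inE hy orbT.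
by apply: hg; rewrite inE hy orbT.
Qed.

Lemma traject_block s m :
  traject s m #|porbit s m| = m :: behead (traject s m #|porbit s m|).
Proof. by case: #|_| (card_porbit_neq0 s m). Qed.

Lemma erased_inj s t : erased s = erased t -> standard_cycles s = standard_cycles t.
Proof.
pose f u m := behead (traject (u : {perm 'I_n}) m #|porbit u m|).
have E u : standard_cycles u =
    [seq m :: f u m | m <- enum 'I_n & cycle_max u m].
  by apply: eq_map => m; rewrite traject_block.
have F u m : m \in [seq m <- enum 'I_n | cycle_max u m] ->
    all (fun x => x < m) (f u m).
  rewrite mem_filter => /andP[/forall_inP hm _]; apply/allP => x xf.
  have xm : x \in porbit u m by rewrite porbit_traject traject_block inE xf orbT.
  rewrite ltn_neqAle hm // andbT; apply: contraTneq xf => /val_inj->.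
  by have := uniq_traject_porbit u m; rewrite traject_block => /andP[].
have P u : pairwise (fun x y : 'I_n => x < y) [seq m <- enum 'I_n | cycle_max u m].
  apply: pairwise_filter.
  by rewrite -(pairwise_map val ltn) val_enum_ord -sorted_pairwise
             ?iota_ltn_sorted //; apply: ltn_trans.
by rewrite /erased !E => e; apply: flatten_blocks_inj; rewrite //; apply: F.
Qed.

Lemma standard_cycles_fcycle s c : c \in standard_cycles s -> fcycle s c.
Proof.
case/mapP => m _ ->; case E: #|_| (card_porbit_neq0 s m) => [//|k] _ /=.
rewrite rcons_path fpath_traject last_traject /=.
by rewrite -iterS -E iter_porbit eqxx.
Qed.

Lemma standard_cycles_inj s t : standard_cycles s = standard_cycles t -> s = t.
Proof.
move=> e; apply/permP => x.
have /flattenP[c cs xc] := mem_erased s x.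
have := next_cycle (standard_cycles_fcycle cs) xc => /eqP->.
by rewrite e in cs; have := next_cycle (standard_cycles_fcycle cs) xc => /eqP->.
Qed.

Lemma theta_inj : injective theta.
Proof.
by move=> s t e; apply/standard_cycles_inj/erased_inj; rewrite -!one_line_theta e.
Qed.

Definition hat pi : {perm 'I_n} := invF theta_inj pi.

End FundamentalBijection.

Record arrow_pattern (k : nat) := ArrowPattern {
  pat_word : seq 'I_k;
  pat_arrows : {set 'I_k * 'I_k};
  pat_covers : forall i : 'I_k, (i \in pat_word) ||
    [exists e in pat_arrows, (i == e.1) || (i == e.2)]
}.

(* The family x enumerates X = {x_1 < ... < x_k}; being a [subseq] of the
   one-line notation amounts to the existence of positions t_1 < ... < t_m. *)
Definition contains n k (pi : {perm 'I_n}) (p : arrow_pattern k) : bool :=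
  [exists x : {ffun 'I_k -> 'I_n},
    [&& [forall i : 'I_k, forall j : 'I_k, (i < j) ==> (x i < x j)],
        subseq [seq x a | a <- pat_word p] (one_line pi)
      & [forall e in pat_arrows p, hat pi (x e.1) == x e.2]]].

Definition avoiders n k (p : arrow_pattern k) : nat :=
  #|[set pi : {perm 'I_n} | ~~ contains pi p]|.

Definition Bell (m : nat) : nat :=
  #|[set P : {set {set 'I_m}} | partition P [set: 'I_m]]|.

Lemma pat12_23_covers (i : 'I_3) :
  (i \in [:: inord 0; inord 1]) ||
  [exists e in [set (inord 1 : 'I_3, inord 2 : 'I_3)], (i == e.1) || (i == e.2)].
Proof.
rewrite !inE; case: i => [[|[|[|//]]] h].
- by rewrite -val_eqE /= inordK.
- by rewrite -!val_eqE /= !inordK // orbT.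
- apply/orP; right; apply/exists_inP; exists (inord 1, inord 2); first by rewrite inE.
  by rewrite -!val_eqE /= !inordK.
Qed.

(* The pattern (12; 2 -> 3). *)
Definition pat12_23 : arrow_pattern 3 :=
  @ArrowPattern 3 [:: inord 0; inord 1] [set (inord 1, inord 2)] pat12_23_covers.

(* Main.v *)
Require Import Defs.
From mathcomp Require Import all_boot all_fingroup zify.

(** Reading the standard cycle form, [pi] avoids (12; 2 -> 3) iff every letter
    of its one-line word is a left-to-right minimum, a left-to-right maximum,
    or is followed by a smaller letter.  In such a word let F be the set of
    left-to-right maxima that are neither left-to-right minima nor followed by
    a smaller letter (the fixed points of [hat pi] other than the first
    letter).  Once F is erased, each left-to-right minimum is followed by a
    decreasing run up to the next one, and the word ends with its smallest
    letter 1: the erased word is a set partition of the remaining letters in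
    which {1} is a block.  Every letter f of F sits just before the first
    non-F letter greater than f (or at the end), which is possible exactly
    when f exceeds all block minima.  Hence avoiders correspond to set
    partitions of {2..n} together with a bit telling whether the block with
    the largest minimum is F or F is empty. *)

Set Implicit Arguments.
Unset Strict Implicit.
Unset Printing Implicit Defensive.

(** * Avoidance as a condition on the one-line word *)

Section WordOfCycles.

Variable n : nat.
Implicit Types (s pi : {perm 'I_n}) (x y a b c m : 'I_n).

(** Cycles come by increasing maxima, so those written before the cycle of [m] have all their
    letters below [m]. *)
Lemma erased_split s m : cycle_max s m -> exists u v : seq 'I_n,
  erased s = u ++ traject s m #|porbit s m| ++ v /\ all (fun x => x < m) u.
Proof.
move=> hm; rewrite /erased /standard_cycles.
have: m \in [seq m <- enum 'I_n | cycle_max s m] by rewrite mem_filter hm mem_enum.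
have: pairwise (fun x y : 'I_n => x < y) [seq m <- enum 'I_n | cycle_max s m].
  apply: pairwise_filter.
  by rewrite -(pairwise_map val ltn) val_enum_ord -sorted_pairwise
             ?iota_ltn_sorted //; apply: ltn_trans.
have: all (cycle_max s) [seq m <- enum 'I_n | cycle_max s m] by apply: filter_all.
move=> + + /splitPr E; case: E => l1 l2.
rewrite all_cat pairwise_cat allrel_consr => /andP[hl1 _] /andP[/andP[ltm _] _].
exists (flatten [seq traject s m #|porbit s m| | m <- l1]).
exists (flatten [seq traject s m #|porbit s m| | m <- l2]).
rewrite map_cat flatten_cat; split=> //.
apply/allP => x /flattenP[_ /mapP[m' m'l ->]].
rewrite -porbit_traject => xm'.
apply: leq_ltn_trans (allP ltm _ m'l).
by have /forall_inP := allP hl1 _ m'l; apply.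
Qed.

Lemma index_cycle_max s m x : cycle_max s m ->
  index x (erased s) < index m (erased s) -> x < m.
Proof.
case/erased_split=> u [v [-> hu]]; rewrite !index_cat traject_block mem_head /= eqxx.
have -> : m \in u = false by apply/negP => /(allP hu); rewrite ltnn.
case: ifP => [/(allP hu)|_] //. by rewrite addn0 ltnNge leq_addr.
Qed.

Lemma index_cycle_max_le s m x : cycle_max s m -> x \in porbit s m ->
  index m (erased s) <= index x (erased s).
Proof.
case/erased_split=> u [v [e hu]] xm; have := uniq_erased s; rewrite e.
rewrite cat_uniq => /and3P[_ /hasPn nu _].
rewrite !index_cat; have mem y : y \in porbit s m -> y \in u = false.
  by move=> ym; apply/negbTE/nu; rewrite mem_cat -porbit_traject ym.
by rewrite !mem ?porbit_id // traject_block mem_head /= eqxx addn0 leq_addr.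
Qed.

(** Inside a cycle the word follows the orbit; the one image not written next is that of the last
    letter, which is the maximum opening the cycle. *)
Lemma index_image s x : ~~ cycle_max s (s x) ->
  index (s x) (erased s) = (index x (erased s)).+1.
Proof.
have [m hm] := cycle_max_ex s x.
have [u [v [e _]]] := erased_split hm.
rewrite porbit_traject => /trajectP[j jk xE] nsx.
have jk1 : j.+1 < #|porbit s m|.
  rewrite ltn_neqAle jk andbT; apply: contraNneq nsx => jE.
  by rewrite xE -iterS jE iter_porbit.
have E i : i < #|porbit s m| -> index (iter i s m) (erased s) = size u + i.
  move=> ik; rewrite -(nth_traject s ik m).
  have -> : nth m (traject s m #|porbit s m|) i = nth m (erased s) (size u + i).
    by rewrite e !nth_cat ltnNge leq_addr addKn /= size_traject ik.
  rewrite index_uniq ?uniq_erased // e !size_cat size_traject ltn_add2l.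
  exact: leq_trans ik (leq_addr _ _).
by rewrite xE -iterS !E // addnS.
Qed.

Definition pos pi x : 'I_n := (pi^-1)%g x.

Definition lr_min pi b := [forall a, (pos pi a < pos pi b) ==> (b < a)].
Definition lr_max pi b := [forall a, (pos pi a < pos pi b) ==> (a < b)].
Definition next_lt pi b :=
  [exists c, (pos pi c == (pos pi b).+1 :> nat) && (c < b)].

Definition smooth pi := [forall b, [|| lr_min pi b, lr_max pi b | next_lt pi b]].

Lemma pos_inj pi : injective (pos pi).
Proof. exact: perm_inj. Qed.

Lemma posK pi x : pos pi (pi x) = x.
Proof. exact: permK. Qed.

Lemma index_one_line pi x : index x (one_line pi) = pos pi x.
Proof.
rewrite -{1}(permKV pi x) /one_line index_map ?index_enum_ord //.
exact: perm_inj.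
Qed.

Lemma index_erased_hat pi x : index x (erased (hat pi)) = pos pi x.
Proof. by rewrite -one_line_theta /hat f_invF index_one_line. Qed.

Lemma subseq2_one_line pi x y : x != y ->
  subseq [:: x; y] (one_line pi) = (pos pi x < pos pi y).
Proof.
move=> xy; have memw z : z \in one_line pi.
  by rewrite -(permKV pi z) map_f // mem_enum.
have := mem2E (one_line pi) x y; rewrite (negbTE xy) => <-.
have uw : uniq (one_line pi) by rewrite map_inj_uniq ?enum_uniq //; apply: perm_inj.
rewrite -!index_one_line /mem2; set w := one_line pi in memw uw *.
have := cat_take_drop (index x w) w; set t := take _ _; set d := drop _ _ => e.
have st : size t = index x w by rewrite size_takel // index_size.
have := memw y; have := uw; rewrite -{1 2}e cat_uniq mem_cat.
case/and3P=> _ /hasPn nd _; rewrite ltn_neqAle.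
have -> : index x w != index y w.
  apply: contra xy => /eqP exy.
  by rewrite -(nth_index x (memw x)) exy nth_index.
rewrite -{2}e index_cat st; case: ifP => [yt _|_ /= yd].
  rewrite leqNgt -st index_mem yt /=; apply/negP => yd.
  by have := nd y yd; rewrite /= yt.
by rewrite leq_addr.
Qed.

(** The arrow forces the third value to be [hat pi b], where [b] is the second, so an occurrence is
    a letter [b] below its image with a smaller letter before it. *)
Lemma avoidsP pi : reflect
  (forall b, b < hat pi b -> lr_min pi b) (~~ contains pi pat12_23).
Proof.
have o2 (i : 'I_3) : [\/ i = inord 0, i = inord 1 | i = inord 2].
  by case: i => [[|[|[|//]]] h]; [constructor 1|constructor 2|constructor 3];
     apply: val_inj; rewrite /= inordK.
apply: (iffP idP) => [av b hb|av].
  apply/forall_inP => a ab; rewrite ltnNge leq_eqVlt; apply/norP; split.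
    by apply: contraTneq ab => /val_inj->; rewrite ltnn.
  apply: contra av => lab; apply/existsP.
  pose x : {ffun 'I_3 -> 'I_n} := [ffun i : 'I_3 => nth b [:: a; b; hat pi b] i].
  exists x.
  have x0 : x (inord 0) = a by rewrite ffunE inordK.
  have x1 : x (inord 1) = b by rewrite ffunE inordK.
  have x2 : x (inord 2) = hat pi b by rewrite ffunE inordK.
  apply/and3P; split.
  - apply/forallP => i; apply/forallP => j; apply/implyP.
    case: (o2 i) => ->; case: (o2 j) => ->; rewrite !inordK ?x0 ?x1 ?x2 //= => _.
    exact: ltn_trans hb.
  - rewrite /= x0 x1 subseq2_one_line //.
    by apply: contraTneq lab => ->; rewrite ltnn.
  - by apply/forall_inP => e /set1P->; rewrite /= x1 x2.
apply/negP => /existsP[x /and3P[/forallP inc sub /forall_inP arr]].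
have lt i j : i < j < 3 -> x (inord i) < x (inord j).
  case/andP=> ij j3; have /forallP/(_ (inord j)) := inc (inord i).
  by rewrite !inordK ?ij // (leq_trans ij (ltnW j3)).
have /eqP e := arr _ (set11 _); rewrite /= in e.
have := av (x (inord 1)); rewrite e lt // => /(_ isT) /forall_inP/(_ (x (inord 0))).
move: sub; rewrite /= subseq2_one_line; last by rewrite neq_ltn lt.
by move=> -> /(_ isT); rewrite ltnNge ltnW // lt.
Qed.

Lemma avoids_smooth pi : ~~ contains pi pat12_23 = smooth pi.
Proof.
set s := hat pi.
have lrM m : cycle_max s m -> lr_max pi m.
  move=> hm; apply/forall_inP => a; rewrite -!index_erased_hat.
  exact: index_cycle_max.
have posS b : ~~ cycle_max s (s b) -> pos pi (s b) = (pos pi b).+1 :> nat.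
  by rewrite -!index_erased_hat; apply: index_image.
have cm b y : y \in porbit s b -> b < y -> ~~ cycle_max s b.
  move=> yb lt; apply/negP => /forall_inP/(_ _ yb); by rewrite leqNgt lt.
have sb b : s b \in porbit s b by have := mem_porbit s 1 b; rewrite expg1.
apply/avoidsP/forallP => [av b | sm b bs].
  have [lt|lt|eq] := ltngtP b (s b).
  - by rewrite av.
  - have nsb : ~~ cycle_max s (s b).
      by apply: cm lt; rewrite porbit_sym.
    apply/or3P/Or33/existsP; exists (s b); by rewrite posS // eqxx.
  - rewrite lrM ?orbT //; apply/forall_inP => y.
    case/porbitP=> i ->; elim: i => [|i IH]; first by rewrite perm1.
    by rewrite expgS permM -(val_inj eq).
have /or3P[//|/forall_inP bM|/existsP[c /andP[/eqP pc cb]]] := sm b.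
  (* As [b] is below its image, the maximum [m] of its cycle is another letter, written earlier, so
     [b] is no left-to-right maximum. *)
  have [m hm bm] := cycle_max_ex s b.
  have mb : b < m.
    have e : porbit s b = porbit s m by apply/eqP; rewrite eq_porbit_mem.
    by apply: leq_trans bs _; have /forall_inP := hm; apply; rewrite -e.
  have := index_cycle_max_le hm bm; rewrite !index_erased_hat leq_eqVlt.
  case/orP=> [/eqP/val_inj/pos_inj e|/bM]; last by rewrite ltnNge ltnW.
  by rewrite e ltnn in mb.
(* Preceded by the larger [b], the letter [c] opens no cycle, hence it is the image of the letter
   before it, namely [b]. *)
have [hc|nc] := boolP (cycle_max s c).
  by have /forall_inP/(_ b) := lrM c hc; rewrite pc leqnn ltnNge ltnW // => /(_ isT).
have := posS ((s^-1)%g c); rewrite permKV pc => /(_ nc) [].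
by move/val_inj/pos_inj=> e; move: bs; rewrite e permKV ltnNge ltnW -?e.
Qed.

End WordOfCycles.

(** * Codes and the order of letters they prescribe *)

Section Codes.

Variable m : nat.
Notation I := 'I_m.+1.
Implicit Types (pi : {perm I}) (h : {ffun I -> I}) (x y z a b c f : I).

(** The set F above. *)
Definition late_fixed pi :=
  [set x | [&& lr_max pi x, ~~ lr_min pi x & ~~ next_lt pi x]].

Definition prefix_min pi x := [arg min_(y < x | pos pi y <= pos pi x) (y : nat)].

(* Sends F to the letter 1, here [ord0], and any other letter to the minimum of
   its block. *)
Definition code pi : {ffun I -> I} :=
  [ffun x => if x \in late_fixed pi then ord0 else prefix_min pi x].

Definition free h x := (x != ord0) && (h x == ord0).

(** Idempotent maps below the identity are set partitions, each letter going to the minimum of its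
    block; the block of [ord0] is read as {1} together with F. *)
Definition codes : {set {ffun I -> I}} :=
  [set h : {ffun I -> I} | [&& [forall x, h x <= x], [forall x, h (h x) == h x]
             & [forall x, free h x ==> [forall y, h y < x]]]].

(** The order once F is erased: blocks by decreasing minima, each being its minimum followed by a
    decreasing run. *)
Definition block_before h x y := (h y < h x) ||
  [&& h x == h y, y != h y & (x == h x) || (y < x)].

(** A letter [f] of F sits before the first larger letter outside F, so it precedes [y] exactly when
    such a letter occurs up to [y]. *)
Definition reaches h y f :=
  [exists z, [&& ~~ free h z, (z == y) || block_before h z y & f < z]].

(* The order in which the letters of the word with code [h] must appear; F is
   the set of the [x] with [free h x]. *)
Definition code_before h x y :=
  if free h x then (if free h y then x < y else reaches h y x)
  else (if free h y then ~~ reaches h x y else block_before h x y).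

Lemma block_before_trans h y x z :
  block_before h x y -> block_before h y z -> block_before h x z.
Proof. by rewrite /block_before -!val_eqE /=; lia. Qed.

Lemma block_before_asym h x y : block_before h x y -> ~~ block_before h y x.
Proof. by rewrite /block_before -!val_eqE /=; lia. Qed.

Lemma block_before_total h x y :
  x != y -> ~~ block_before h x y -> block_before h y x.
Proof. by rewrite /block_before -!val_eqE /=; lia. Qed.

Lemma reaches_trans h x y f : x = y \/ block_before h x y ->
  reaches h x f -> reaches h y f.
Proof.
move=> xy /existsP[z /and3P[fz zx ltz]]; apply/existsP; exists z.
rewrite fz ltz andbT /=; case: xy => [<- //|xy].
case/orP: zx => [/eqP->|zx]; first by rewrite xy orbT.
by rewrite (block_before_trans zx xy) orbT.
Qed.

Lemma reaches_ltn h y f (g : I) : f < g -> reaches h y g -> reaches h y f.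
Proof.
move=> fg /existsP[z /and3P[fz zx ltz]]; apply/existsP; exists z.
by rewrite fz zx (ltn_trans fg).
Qed.

Lemma code_before_irr h x : code_before h x x = false.
Proof.
rewrite /code_before; case: (free h x); first by rewrite ltnn.
by apply/negbTE/negP => e; have := block_before_asym e; rewrite e.
Qed.

Lemma code_before_asym h x y : code_before h x y -> ~~ code_before h y x.
Proof.
rewrite /code_before; case: (free h x); case: (free h y) => //.
- by move/ltnW; rewrite -leqNgt.
- by rewrite negbK.
- exact: block_before_asym.
Qed.

Lemma code_before_total h x y :
  x != y -> ~~ code_before h x y -> code_before h y x.
Proof.
move=> xy; rewrite /code_before; case: (free h x); case: (free h y) => //.
- by rewrite -leqNgt leq_eqVlt val_eqE eq_sym (negbTE xy).
- by rewrite negbK.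
- exact: block_before_total.
Qed.

Lemma code_before_trans h y x z :
  code_before h x y -> code_before h y z -> code_before h x z.
Proof.
rewrite /code_before.
case: (free h x); case: (free h y); case: (free h z) => //.
- exact: ltn_trans.
- exact: reaches_ltn.
(* The letter [u] exceeds [x] and occurs up to [y], where no letter outside F exceeds [z], so
   [x < u <= z]. *)
- case/existsP=> u /and3P[fu uy xu] nr; apply: leq_trans xu _.
  rewrite leqNgt; apply: contra nr => zu.
  by apply/existsP; exists u; rewrite fu uy.
- by move=> r yz; apply: reaches_trans r; right.
- by move=> nr yz; apply: contra nr; apply: reaches_ltn.
- move=> nr r; case: (eqVneq x z) => [e|xz]; first by rewrite e r in nr.
  apply: contraR nr => /(block_before_total xz) zx.
  by apply: reaches_trans r; right.
- by move=> xy; apply: contra; apply: reaches_trans; right.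
- exact: block_before_trans.
Qed.

(** * The code of a smooth word prescribes its order *)

Section CodeOfSmooth.

Variable pi : {perm I}.
Hypothesis smooth_pi : smooth pi.
Notation h := (code pi).

Lemma pos_neq x y : pos pi x < pos pi y -> x != y.
Proof. by apply: contraTneq => ->; rewrite ltnn. Qed.

Lemma lr_min_ord0 : lr_min pi ord0.
Proof.
apply/forall_inP => a /pos_neq a0.
by rewrite lt0n.
Qed.

Lemma smooth_next x : x \notin late_fixed pi -> ~~ lr_min pi x -> next_lt pi x.
Proof.
have /forallP/(_ x) := smooth_pi; rewrite inE.
by case: lr_min; case: lr_max; case: next_lt.
Qed.

Lemma next_notlate x c :
  pos pi c = (pos pi x).+1 :> nat -> c < x -> c \notin late_fixed pi.
Proof.
move=> pc cx; rewrite inE; apply/negP => /and3P[/forall_inP/(_ x) + _ _].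
by rewrite pc leqnn => /(_ isT); rewrite ltnNge ltnW.
Qed.

(** By smoothness the letter after [x] is smaller; having a larger letter before it, it is outside
    F, so the descent continues as long as no left-to-right minimum is met. *)
Lemma descending x y : x \notin late_fixed pi -> ~~ lr_min pi x ->
  pos pi x < pos pi y ->
  (forall z, pos pi x < pos pi z <= pos pi y -> ~~ lr_min pi z) -> y < x.
Proof.
move=> + + /subnKC; move: (_ - _) => d.
elim: d x => [|d IH] x lx mx e hz.
  case/existsP: (smooth_next lx mx) => c /andP[/eqP pc cx].
  by move: e; rewrite addn0 -pc => /val_inj/pos_inj<-.
case/existsP: (smooth_next lx mx) => c /andP[/eqP pc cx].
apply: (ltn_trans _ cx); apply: IH.
- exact: next_notlate cx.
- by apply: hz; rewrite pc leqnn -e leq_addr.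
- by rewrite pc -e addSnnS.
- by move=> z; rewrite pc => /andP[h1 h2]; apply: hz; rewrite h2 ltnW.
Qed.

(* Descending from such an [x] would never stop: the next letter is again
   neither late, nor a left-to-right minimum. *)
Lemma no_next_after_ord0 x : pos pi ord0 < pos pi x -> ~~ next_lt pi x.
Proof.
have [k] := ubnP x; elim: k x => // k IH x lek p0x.
apply/negP=> /existsP[c /andP[/eqP pc cx]].
have p0c : pos pi ord0 < pos pi c by rewrite pc ltnW.
have /negP[] := IH c (leq_trans cx lek) p0c.
apply: smooth_next (next_notlate pc cx) _.
by apply/negP => /forall_inP/(_ _ p0c).
Qed.

Lemma prefix_minP x : [/\ lr_min pi (prefix_min pi x),
  pos pi (prefix_min pi x) <= pos pi x
  & forall a, pos pi a <= pos pi x -> prefix_min pi x <= a].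
Proof.
rewrite /prefix_min; case: arg_minnP => // y py hy; split=> //.
apply/forall_inP => a pa; rewrite ltn_neqAle hy ?andbT.
  by rewrite val_eqE eq_sym pos_neq.
exact: leq_trans (ltnW pa) py.
Qed.

Lemma lr_min_notlate x : lr_min pi x -> x \notin late_fixed pi.
Proof. by move=> mx; rewrite inE mx andbF. Qed.

Lemma prefix_min_id x : lr_min pi x -> prefix_min pi x = x.
Proof.
case: (prefix_minP x) => _ + /(_ x (leqnn _)) + /forall_inP/(_ (prefix_min pi x)).
rewrite leq_eqVlt => /orP[/eqP/val_inj/pos_inj//|-> +  /(_ isT)].
by rewrite leqNgt => /negbTE->.
Qed.

Lemma code_lr_min x : lr_min pi (h x).
Proof.
rewrite ffunE; case: ifP => _; first exact: lr_min_ord0.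
by case: (prefix_minP x).
Qed.

Lemma code_id x : lr_min pi x -> h x = x.
Proof. by move=> mx; rewrite ffunE (negbTE (lr_min_notlate mx)) prefix_min_id. Qed.

Lemma lr_min_ltn_late x y : lr_min pi x -> y \in late_fixed pi -> x < y.
Proof.
move=> /[dup] mx /forall_inP mxx; rewrite inE => /and3P[/forall_inP My my _].
have [/My//|/mxx//|/val_inj/pos_inj e] := ltngtP (pos pi x) (pos pi y).
by rewrite e (negbTE my) in mx.
Qed.

(** Only letters of F can follow [ord0], so no letter outside F other than [ord0] has prefix minimum
    [ord0], and marking F by [ord0] is unambiguous. *)
Lemma free_code x : free h x = (x \in late_fixed pi).
Proof.
rewrite /free ffunE; case: ifP => [lx|/negbT lx].
  rewrite eqxx andbT; apply: contraTneq lx => ->.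
  exact/lr_min_notlate/lr_min_ord0.
apply/negP => /andP[x0 /eqP e].
case: (prefix_minP x); rewrite e => _ + _; rewrite leq_eqVlt.
case/orP=> [/eqP/val_inj/pos_inj e0|p0]; first by rewrite e0 eqxx in x0.
have /negP[] := no_next_after_ord0 p0.
by apply: smooth_next => //; apply/negP => /forall_inP/(_ _ p0).
Qed.

Lemma code_codes : h \in codes.
Proof.
rewrite inE; apply/and3P; split; apply/forallP => x.
- rewrite ffunE; case: ifP => // _.
  by case: (prefix_minP x) => _ _; apply.
- by rewrite (code_id (code_lr_min x)).
- apply/implyP; rewrite free_code => lx; apply/forallP => y.
  exact: lr_min_ltn_late (code_lr_min y) lx.
Qed.

Lemma block_before_code x y : x \notin late_fixed pi -> y \notin late_fixed pi ->
  pos pi x < pos pi y -> block_before h x y.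
Proof.
move=> lx ly xy; rewrite /block_before !ffunE (negbTE lx) (negbTE ly).
have [mx px hx] := prefix_minP x; have [my py hy] := prefix_minP y.
have := hy _ (leq_trans px (ltnW xy)); rewrite leq_eqVlt => /orP[/eqP/val_inj e|->//].
rewrite e eqxx /=; apply/orP; right; apply/andP; split.
  by apply: contraTneq xy => yE; rewrite -leqNgt yE.
case: eqVneq => //= nx; apply: descending => // [|z /andP[xz zy]].
  apply: contra nx => /prefix_min_id ->; exact: eqxx.
apply/negP => /forall_inP/(_ (prefix_min pi x) (leq_ltn_trans px xz)).
by rewrite -e ltnNge hy.
Qed.

Lemma pos_block_before x y : x \notin late_fixed pi -> y \notin late_fixed pi ->
  block_before h x y -> pos pi x < pos pi y.
Proof.
move=> lx ly b; rewrite ltnNge leq_eqVlt; apply/norP; split.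
  apply/negP => /eqP/val_inj/pos_inj e; rewrite e in b.
  by have := block_before_asym b; rewrite b.
by apply: contraL b => /(block_before_code ly lx)/block_before_asym.
Qed.

(** A letter of F is followed by a larger one. Letters therefore increase from [x] until F is left,
    and the first letter outside F is the witness. *)
Lemma reaches_code x y : x \in late_fixed pi -> y \notin late_fixed pi ->
  pos pi x < pos pi y -> reaches h y x.
Proof.
move=> + ly /subnKC; move: (_ - _) => d; elim: d x => [|d IH] x lx e.
  have xy : pos pi x < pos pi y by rewrite -e addn0.
  apply/existsP; exists y; rewrite free_code ly eqxx /=.
  have := lx; rewrite inE => /and3P[_ _]; apply: contraR; rewrite -leqNgt leq_eqVlt.
  rewrite val_eqE eq_sym (negbTE (pos_neq xy)) /= => yx.
  by apply/existsP; exists y; rewrite yx -e addn0 eqxx.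
have xs : (pos pi x).+1 < m.+1 by rewrite (leq_ltn_trans _ (ltn_ord (pos pi y))) // -e leq_addr.
pose c := pi (Ordinal xs).
have pc : pos pi c = (pos pi x).+1 :> nat by rewrite posK.
have xc : x < c.
  rewrite ltnNge leq_eqVlt val_eqE; apply/norP; split.
    by rewrite eq_sym pos_neq // pc.
  have := lx; rewrite inE => /and3P[_ _]; apply: contra => cx.
  by apply/existsP; exists c; rewrite pc eqxx.
have [lc|lc] := boolP (c \in late_fixed pi).
  by apply: reaches_ltn xc _; apply: IH; rewrite // pc -e addSnnS.
apply/existsP; exists c; rewrite free_code lc xc andbT /=.
apply/orP; right; apply: block_before_code => //.
by rewrite pc -e -addSnnS leq_addr.
Qed.

Lemma code_before_pos x y : pos pi x < pos pi y -> code_before h x y.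
Proof.
move=> xy; rewrite /code_before !free_code.
case: ifPn => lx; case: ifPn => ly.
- by have := ly; rewrite inE => /and3P[/forall_inP/(_ _ xy)].
- exact: reaches_code.
- apply/negP => /existsP[z /and3P[]]; rewrite free_code => lz zx yz.
  have pz : pos pi z < pos pi y.
    case/orP: zx => [/eqP->//|/(pos_block_before lz lx)/ltn_trans]; exact.
  have := ly; rewrite inE => /and3P[/forall_inP/(_ _ pz)].
  by rewrite ltnNge ltnW.
- exact: block_before_code.
Qed.

Lemma pos_code_before x y : (pos pi x < pos pi y) = code_before h x y.
Proof.
apply/idP/idP => [|b]; first exact: code_before_pos.
rewrite ltnNge leq_eqVlt; apply/norP; split.
  by apply/negP => /eqP/val_inj/pos_inj e; rewrite e code_before_irr in b.
by apply: contraL b => /code_before_pos/code_before_asym.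
Qed.

End CodeOfSmooth.

(** Recovers positions from the relative order of the letters, which makes [code] injective. *)
Lemma card_pos_ltn pi x : #|[set y | pos pi y < pos pi x]| = pos pi x.
Proof.
have -> : [set y | pos pi y < pos pi x] = pi @: [set i : I | i < pos pi x].
  apply/setP => y; apply/idP/imsetP => [|[i + ->]]; rewrite !inE.
    by move=> yx; exists (pos pi y); rewrite ?inE // permKV.
  by rewrite posK.
rewrite card_imset; last exact: perm_inj.
rewrite cardsE -sum1_card (big_ord_narrow (ltnW (ltn_ord (pos pi x)))) /=.
by rewrite sum1_card card_ord.
Qed.

Lemma code_inj : {in [pred pi | smooth pi] &, injective code}.
Proof.
move=> p q sp sq e; have posE x : pos p x = pos q x.
  apply: val_inj; rewrite /= -(card_pos_ltn p) -(card_pos_ltn q).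
  by apply: eq_card => y; rewrite !inE !pos_code_before // e.
by apply: invg_inj; apply/permP; apply: posE.
Qed.

(** * Every code is the code of a smooth word *)

Section SmoothOfCode.

Variable h : {ffun I -> I}.
Hypothesis h_codes : h \in codes.

(** Since [code_before h] is a strict total order, each letter can be placed at its number of
    predecessors. *)
Lemma code_pos_exists : exists pi, forall x y, (pos pi x < pos pi y) = code_before h x y.
Proof.
pose D x := [set y | code_before h y x].
have ltD x : #|D x| < m.+1.
  suff: #|D x| < #|[set: I]| by rewrite cardsT card_ord.
  apply: proper_card.
  by rewrite properT; apply/negP => /eqP/setP/(_ x); rewrite !inE code_before_irr.
have lt x y : code_before h x y -> #|D x| < #|D y|.
  move=> xy; apply: proper_card; apply/properP; split.
    by apply/subsetP => z; rewrite !inE => /code_before_trans; apply.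
  by exists x; rewrite !inE ?code_before_irr.
pose p x := Ordinal (ltD x).
have p_inj : injective p.
  move=> x y /(congr1 val) /= e; apply/eqP; apply: contra_eqT e => xy.
  rewrite neq_ltn; have [/lt->//|/(code_before_total xy)/lt->] := boolP (code_before h x y).
  by rewrite orbT.
exists (perm p_inj)^-1%g => x y; rewrite /pos invgK !permE /=.
apply/idP/idP => [l|]; last exact: lt.
have xy : x != y by apply: contraTneq l => ->; rewrite ltnn.
by apply: contraLR l => /(code_before_total xy)/lt/ltnW; rewrite -leqNgt.
Qed.

Lemma code_leq x : h x <= x.
Proof. by have := h_codes; rewrite inE => /and3P[/forallP]. Qed.

Lemma code_idem x : h (h x) = h x.
Proof. by have := h_codes; rewrite inE => /and3P[_ /forallP/(_ x)/eqP]. Qed.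

Lemma code_free_ltn x y : free h x -> h y < x.
Proof.
have := h_codes; rewrite inE => /and3P[_ _ /forallP/(_ x)/implyP + ] fx.
by move=> /(_ fx)/forallP.
Qed.

Lemma code_ord0 : h ord0 = ord0.
Proof. by apply/val_inj/eqP; rewrite -leqn0 code_leq. Qed.

Lemma free_image x : ~~ free h (h x).
Proof.
by apply/negP => /(@code_free_ltn _ x); rewrite ltnn.
Qed.

Variable pi : {perm I}.
Hypothesis posE : forall x y, (pos pi x < pos pi y) = code_before h x y.

Lemma block_leq x y : block_before h x y -> h y <= x.
Proof. by have := code_leq x; rewrite /block_before -!val_eqE /=; lia. Qed.

Lemma image_leq x a : ~~ free h x -> pos pi a <= pos pi x -> h x <= a.
Proof.
move=> fx; rewrite leq_eqVlt => /orP[/eqP/val_inj/pos_inj->|]; first exact: code_leq.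
rewrite posE /code_before (negbTE fx); case: ifP => fa; last exact: block_leq.
by rewrite ltnW // code_free_ltn.
Qed.

Lemma image_lr_min x : lr_min pi (h x).
Proof.
apply/forall_inP => a /[dup] ax /ltnW/(image_leq (free_image x)).
by rewrite code_idem leq_eqVlt val_eqE eq_sym (negbTE (pos_neq ax)).
Qed.

Lemma free_lr_max x : free h x -> lr_max pi x.
Proof.
move=> fx; apply/forall_inP => a /[dup] ax; rewrite posE /code_before fx.
case: ifPn => // fa; apply: contraR; rewrite -leqNgt leq_eqVlt val_eqE.
rewrite eq_sym (negbTE (pos_neq ax)) /= => xa.
by apply/existsP; exists a; rewrite fa eqxx.
Qed.

Lemma free_not_lr_min x : free h x -> ~~ lr_min pi x.
Proof.
move=> fx; apply/negP => /forall_inP mx.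
(* The largest block minimum [M] comes first among the letters outside F. As [M < x], it precedes
   [x] in the word. *)
pose M := [arg max_(y > ord0 | h y == y) (y : nat)].
have [hM maxM] : h M = M /\ forall y, h y <= M.
  rewrite /M; case: arg_maxnP => [|y /eqP hy maxy]; first by rewrite code_ord0.
  by split=> // z; apply: maxy; rewrite /= code_idem.
have fM : ~~ free h M by rewrite -hM free_image.
have Mx : M < x by rewrite -hM code_free_ltn.
suff /mx : pos pi M < pos pi x by rewrite ltnNge ltnW.
rewrite posE /code_before fx (negbTE fM).
apply/negP => /existsP[z /and3P[fz /orP[/eqP->|]]]; first by rewrite ltnNge ltnW.
have := maxM z; rewrite /block_before hM eqxx andbF orbF.
by rewrite leqNgt => /negbTE->.
Qed.

Lemma free_not_next_lt x : free h x -> ~~ next_lt pi x.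
Proof.
move=> fx; apply/negP => /existsP[c /andP[/eqP pc cx]].
have xc : pos pi x < pos pi c by rewrite pc.
have := xc; rewrite posE /code_before fx; case: ifPn => [_|fc].
  by rewrite ltnNge ltnW.
case/existsP=> z /and3P[fz zc xz].
have : pos pi z < pos pi x.
  rewrite ltn_neqAle -ltnS -pc.
  case/orP: zc => [/eqP e|zc]; first by rewrite e ltnNge ltnW in xz.
  rewrite posE /code_before (negbTE fz) (negbTE fc) zc andbT.
  by apply/negP => /eqP/val_inj/pos_inj e; rewrite e ltnn in xz.
move/forall_inP: (free_lr_max fx) => Mx /Mx.
by rewrite ltnNge ltnW.
Qed.

Lemma block_next_lt x : ~~ free h x -> x != h x -> next_lt pi x.
Proof.
move=> fx nx; have hx0 : h x != ord0.
  apply: contra fx => hx; rewrite /free hx andbT.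
  by apply: contraNneq nx => ->; rewrite code_ord0.
pose P y := ~~ free h y && block_before h x y.
have P0 : P ord0.
  by rewrite /P /free eqxx /= /block_before code_ord0 /= lt0n hx0.
(* The next letter outside F after [x]; [ord0], the last of these, ensures that there is one. *)
pose d := [arg min_(y < ord0 | P y) (pos pi y : nat)].
have [/andP[fd xd] mind] : P d /\ forall y, P y -> pos pi d <= pos pi y.
  by rewrite /d; case: arg_minnP.
have pxd : pos pi x < pos pi d by rewrite posE /code_before (negbTE fx) (negbTE fd).
(* Either [d] continues the decreasing run of [x], or it lies in a later block and is its minimum,
   which would otherwise come sooner. *)
have dx : d < x.
  case/orP: xd => [hdx | /and3P[_ _]]; last first.
    by rewrite (negbTE nx).
  suff -> : d = h d by apply: leq_trans hdx (code_leq x).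
  apply/eqP; apply: contraLR pxd => nd.
  have : P (h d) by rewrite /P free_image /block_before code_idem hdx.
  move/mind; rewrite leqNgt => /negP[]; rewrite posE /code_before.
  rewrite (negbTE fd) (negbTE (free_image d)) /block_before code_idem.
  by rewrite eqxx nd orbT.
apply/existsP; exists d; rewrite dx andbT eqn_leq pxd andbT leqNgt.
(* The letter [c] right after [x] would be in F. The letter [z] that puts it before [d] is not [d],
   as [d < x < c]; so [z] occurs up to [x] and already puts [c] before [x]. *)
apply/negP => xcd.
have xs : (pos pi x).+1 < m.+1 by apply: ltn_trans xcd _.
pose c := pi (Ordinal xs).
have pc : pos pi c = (pos pi x).+1 :> nat by rewrite posK.
have xc : pos pi x < pos pi c by rewrite pc.
have cd : pos pi c < pos pi d by rewrite pc.
have [fc|fc] := boolP (free h c); last first.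
  have /mind : P c by move: xc; rewrite /P fc posE /code_before (negbTE fx) (negbTE fc).
  by rewrite leqNgt cd.
move: (xc) (cd); rewrite !posE /code_before (negbTE fx) (negbTE fd) fc.
move=> /existsP nr /existsP[z /and3P[fz zd cz]].
case: nr; exists z; rewrite fz cz andbT /=.
case: eqVneq => //= zx.
have zd' : z != d.
  apply: contraTneq cz => ->; rewrite -leqNgt (leq_trans (ltnW dx)) //.
  by have /forall_inP/(_ _ xc)/ltnW := free_lr_max fc.
rewrite (negbTE zd') /= in zd.
apply: contraLR zd => nzx.
have /mind : P z by rewrite /P fz block_before_total.
rewrite leqNgt posE /code_before (negbTE fz) (negbTE fd).
by [].
Qed.

Lemma smooth_code_pos : smooth pi.
Proof.
apply/forallP => x; have [fx|fx] := boolP (free h x).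
  by rewrite free_lr_max ?orbT.
have [->|nx] := eqVneq x (h x); first by rewrite image_lr_min.
by rewrite block_next_lt ?orbT.
Qed.

Lemma code_pos_code : code pi = h.
Proof.
have lateE x : (x \in late_fixed pi) = free h x.
  rewrite inE; have [fx|fx] := boolP (free h x).
    by rewrite free_lr_max ?free_not_lr_min ?free_not_next_lt.
  have [->|nx] := eqVneq x (h x); first by rewrite image_lr_min andbF.
  by rewrite block_next_lt ?andbF.
apply/ffunP => x; rewrite ffunE lateE; case: ifPn => [/andP[_ /eqP->]//|fx].
have [_ px hx] := prefix_minP pi x.
apply/val_inj/eqP; rewrite eqn_leq image_leq // andbT; apply: hx.
rewrite leqNgt posE /code_before (negbTE fx) (negbTE (free_image x)).
by rewrite /block_before code_idem eqxx ltnn andbF.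
Qed.

End SmoothOfCode.

Lemma card_smooth : #|[set pi : {perm I} | smooth pi]| = #|codes|.
Proof.
rewrite -(card_in_imset (f := code)); last first.
  by move=> p q; rewrite !inE; apply: code_inj.
congr #|pred_of_set _|; apply/setP => h; apply/imsetP/idP => [[p + ->]|hc].
  by rewrite inE; apply: code_codes.
have [pi posE] := code_pos_exists h.
by exists pi; rewrite ?inE ?(smooth_code_pos hc posE) ?(code_pos_code hc posE).
Qed.

End Codes.

(** * Counting codes by a set partition and a bit *)

Section Count.

Variable m : nat.
Notation I := 'I_m.+1.
Implicit Types (h : {ffun I -> I}) (x : I) (y z : 'I_m) (P : {set {set 'I_m}}).

(* F, which [h] sends to [ord0], becomes a block of its own since [ord0] itself
   is left out. *)
Definition kernel h :=
  preim_partition (fun y => h (lift ord0 y)) [set: 'I_m].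

Definition has_free h := [exists x, free h x].

Lemma kernelP h y z :
  (z \in pblock (kernel h) y) = (h (lift ord0 y) == h (lift ord0 z)).
Proof.
rewrite /kernel /preim_partition pblock_equivalence_partition ?inE //.
by split=> // /eqP->.
Qed.

Lemma kernel_eq h h' x x' : kernel h = kernel h' -> x != ord0 -> x' != ord0 ->
  (h x == h x') = (h' x == h' x').
Proof.
move=> e; rewrite ![_ == ord0]eq_sym => /unlift_some[y -> _] /unlift_some[z -> _].
by rewrite -!kernelP e.
Qed.

(* Both free sets are classes of the common kernel, and each exceeds the minima
   of all other classes. *)
Lemma same_kernel_free_sub h h' x : h \in codes m -> h' \in codes m ->
  kernel h = kernel h' -> has_free h' -> free h x -> free h' x.
Proof.
move=> hc hc' e /existsP[w fw] fx; apply: contraT => nfx.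
have [x0 hx] := andP fx; have [w0 hw] := andP fw.
have hx'0 : h' x != ord0 by move: nfx; rewrite /free x0.
have hw0 : h w != ord0.
  apply: contra hx'0 => hw0; rewrite -(eqP hw) eq_sym -(kernel_eq e) //.
  by rewrite (eqP hw0) eq_sym.
have fhw : free h' (h w).
  by rewrite /free hw0 -(eqP hw) -(kernel_eq e) // (code_idem hc) eqxx.
have fhx : free h (h' x).
  by rewrite /free hx'0 -(eqP hx) (kernel_eq e) // (code_idem hc') eqxx.
have := code_free_ltn hc w fhx; have := code_free_ltn hc' x fhw.
by move/ltnW; rewrite leqNgt => /negbTE->.
Qed.

(** When [h x] is not [ord0] it lies in the class of [x], so [h'] sends it to [h' x], and [h'] never
    increases a letter. *)
Lemma same_kernel_leq h h' x : h \in codes m -> h' \in codes m ->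
  kernel h = kernel h' -> free h x = free h' x -> h' x <= h x.
Proof.
move=> hc hc' e f; have [->|x0] := eqVneq x ord0.
  by rewrite !code_ord0.
have [hx|hx] := eqVneq (h x) ord0.
  by move: f; rewrite /free x0 hx eqxx /= => /esym/eqP->.
suff /eqP <- : h' (h x) == h' x by apply: code_leq.
by rewrite -(kernel_eq e) // (code_idem hc) eqxx.
Qed.

(** The bit tells whether F is empty; if not, the kernel determines which class it is. *)
Lemma kernel_inj : {in codes m &, injective (fun h => (kernel h, has_free h))}.
Proof.
move=> h h' hc hc' [e ef]; apply/ffunP => x.
have ff : free h x = free h' x.
  apply/idP/idP => fx.
    by apply: (same_kernel_free_sub hc hc') => //; rewrite -ef; apply/existsP; exists x.
  by apply: (same_kernel_free_sub hc' hc) => //; rewrite ef; apply/existsP; exists x.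
by apply/val_inj/eqP; rewrite eqn_leq !same_kernel_leq.
Qed.

Definition block_min P y := [arg min_(z < y | z \in pblock P y) (z : nat)].

Section CodeOfPartition.

Variables (P : {set {set 'I_m}}) (b : bool) (mu : 'I_m).
Hypothesis partP : partition P [set: 'I_m].
Hypothesis mu_id : block_min P mu = mu.
Hypothesis mu_max : forall y, block_min P y <= mu.
Notation g := (block_min P).

Lemma block_minP y : g y \in pblock P y /\ forall z, z \in pblock P y -> g y <= z.
Proof.
rewrite /block_min; case: arg_minnP => //.
by case/and3P: partP => /eqP e _ _; rewrite mem_pblock e inE.
Qed.

Lemma eq_block_min y z : (g y == g z) = (pblock P y == pblock P z).
Proof.
have [gy hy] := block_minP y; have [gz hz] := block_minP z.
case/and3P: partP => _ tP _; apply/eqP/eqP => e.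
  by rewrite -(same_pblock tP gy) e (same_pblock tP gz).
by apply/val_inj/eqP; rewrite eqn_leq hy ?hz // ?e // -e.
Qed.

Lemma block_min_id y : g (g y) = g y.
Proof.
apply/eqP; rewrite eq_block_min; have [gy _] := block_minP y.
by case/and3P: partP => _ tP _; rewrite (same_pblock tP gy).
Qed.

Lemma block_min_leq y : g y <= y.
Proof.
have [_] := block_minP y; apply.
by case/and3P: partP => /eqP e _ _; rewrite mem_pblock e inE.
Qed.

(** Letters of F must exceed the minima of all other blocks, so the block chosen to become F when
    [b] holds is that of the largest minimum [mu]. *)
Definition partition_code : {ffun I -> I} := [ffun x =>
  if unlift ord0 x is Some y then
    if b && (g y == mu) then ord0 else lift ord0 (g y)
  else ord0].
Notation h := partition_code.

Lemma partition_code0 : h ord0 = ord0.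
Proof. by rewrite ffunE unlift_none. Qed.

Lemma partition_code_lift y :
  h (lift ord0 y) = if b && (g y == mu) then ord0 else lift ord0 (g y).
Proof. by rewrite ffunE liftK. Qed.

Lemma free_partition_code y : free h (lift ord0 y) = b && (g y == mu).
Proof.
rewrite /free eq_sym neq_lift partition_code_lift /=.
by case: ifP => //; rewrite eq_sym (negbTE (neq_lift _ _)).
Qed.

Lemma partition_code_codes : h \in codes m.
Proof.
rewrite inE; apply/and3P; split; apply/forallP => x.
- have [y ->|->] := unliftP ord0 x; last by rewrite partition_code0.
  by rewrite partition_code_lift; case: ifP => // _; rewrite !lift0 ltnS block_min_leq.
- have [y ->|->] := unliftP ord0 x; last by rewrite !partition_code0.
  rewrite partition_code_lift; case: ifP => gy; first by rewrite partition_code0.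
  by rewrite partition_code_lift block_min_id gy.
- apply/implyP; have [y ->|->] := unliftP ord0 x; last by rewrite /free eqxx.
  rewrite free_partition_code => /andP[bT /eqP gy]; apply/forallP => x'.
  have [z ->|->] := unliftP ord0 x'; last by rewrite partition_code0 lift0.
  rewrite partition_code_lift bT andTb; case: eqVneq => gz; rewrite !lift0 // ltnS.
  apply: leq_trans (block_min_leq y); rewrite gy ltn_neqAle mu_max andbT.
  by rewrite val_eqE.
Qed.

Lemma kernel_partition_code : kernel h = P.
Proof.
rewrite -[RHS](preim_partition_pblock partP) /kernel /preim_partition.
rewrite /equivalence_partition; apply: eq_imset => y; apply/setP => z.
rewrite !inE -eq_block_min !partition_code_lift.
have l0 t : (lift ord0 t == ord0 :> I) = false by rewrite eq_sym (negbTE (neq_lift _ _)).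
case: b => /=; last by rewrite (inj_eq lift_inj).
case: (eqVneq (g y) mu) => [ey|ny]; case: (eqVneq (g z) mu) => [ez|nz].
- by rewrite ey ez !eqxx.
- by rewrite eq_sym l0 ey eq_sym (negbTE nz).
- by rewrite l0 ez (negbTE ny).
- by rewrite (inj_eq lift_inj).
Qed.

Lemma has_free_partition_code : has_free h = b.
Proof.
apply/existsP/idP => [[x]|bT].
  have [y ->|->] := unliftP ord0 x; first by rewrite free_partition_code => /andP[].
  by rewrite /free eqxx.
by exists (lift ord0 mu); rewrite free_partition_code bT mu_id eqxx.
Qed.

End CodeOfPartition.

Lemma card_codes : 0 < m -> #|codes m| = 2 * Bell m.
Proof.
move=> m0; rewrite -(card_in_imset kernel_inj) /Bell mulnC -card_bool -cardsT -cardsX.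
congr #|pred_of_set _|; apply/setP => -[P b]; rewrite !inE /= andbT.
apply/imsetP/idP => [[h _ [-> _]]|partP].
  by apply: preim_partitionP.
(* The largest block minimum exists because [0 < m] provides a letter to start the search from. *)
pose mu := block_min P [arg max_(y > Ordinal m0) (block_min P y : nat)].
have mu_id : block_min P mu = mu by apply: block_min_id.
have mu_max y : block_min P y <= mu.
  by rewrite /mu; case: arg_maxnP => // z _; apply.
exists (partition_code P b mu); first exact: partition_code_codes.
by rewrite kernel_partition_code // has_free_partition_code.
Qed.

End Count.

Theorem theorem3p8 :
  (forall n : nat, 2 <= n -> avoiders n pat12_23 = 2 * Bell n.-1) /\
  avoiders 1 pat12_23 = 1.
Proof.
have E m : avoiders m.+1 pat12_23 = #|codes m|.
  rewrite -card_smooth; apply: eq_card => pi.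
  by rewrite !inE avoids_smooth.
split=> [[|m] // m1|]; first by rewrite E card_codes.
(* For the one-letter word the constant map is the single map, and it is a code. *)
rewrite E; apply/eqP/cards1P; exists [ffun=> ord0]; apply/setP => h; rewrite !inE.
have -> : h = [ffun=> ord0] by apply/ffunP => i; rewrite !ord1.
rewrite eqxx; apply/and3P; split; apply/forallP => x; rewrite ?ffunE //.
by rewrite /free ord1 eqxx.
Qed.
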